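(* Let $p$ be an odd prime, let $g$ be a (fixed) primitive root modulo $p^2$ with $q_p(g)=\delta$ (so $1\le\delta<p$), and let $\beta\in\overline{\mathbb{F}}_2$ be a primitive $p^2$-th root of unity. Then for $0\le i<p$, the defining pair of the binary sequence $(s^{(i\delta)}_u)$ defined by $$s^{(i\delta)}_u=\begin{cases}1, & \text{if } u\bmod p^2\in D_{i\delta},\\ 0, & \text{otherwise},\end{cases}\qquad u\ge 0,$$ is $(G_{i\delta}(x),\beta)$ with $$G_{i\delta}(x)=\sum_{j=1}^{p-1}x^{jp}+\sum_{j=0}^{p-1}D_{(i+j)\delta}(\beta)\,D_{j\delta}(x),$$ where the numbers $i\delta,\ j\delta,\ (i+j)\delta$ in superscripts and subscripts are reduced modulo $p$.
   Context: Fermat quotient: for an odd prime $p$ and an integer $u$ with $\gcd(u,p)=1$, $q_p(u)$ is the unique integer with $q_p(u)\equiv\frac{u^{p-1}-1}{p}\pmod p$ and $0\le q_p(u)\le p-1$; moreover $q_p(kp)=0$ for all $k\in\mathbb{Z}$. $\mathbb{F}_2=\{0,1\}$ is the binary field and $\overline{\mathbb{F}}_2$ its algebraic closure. For $l=0,1,\ldots,p-1$ let $D_l=\{u:0\le u<p^2,\ \gcd(u,p)=1,\ q_p(u)=l\}$, with the subscript of $D$ taken modulo $p$ (so $D_{l+p}=D_l$), and let $D_l(x)=\sum_{u\in D_l}x^u\in\mathbb{F}_2[x]$. Defining pair: for a binary sequence $(s_u)$ over $\mathbb{F}_2$ of odd period $T$, a primitive $T$-th root of unity $\beta\in\overline{\mathbb{F}}_2$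 and a polynomial $g(x)=\sum_{0\le i<T}\rho_ix^i\in\overline{\mathbb{F}}_2[x]$, the pair $(g(x),\beta)$ is called a defining pair of $(s_u)$ if $s_u=g(\beta^u)$ for all $u\ge 0$. For a given $\beta$, the polynomial $g(x)$ is uniquely determined modulo $x^T-1$. Here $T=p^2$. *)

(* Defs.v *)
From HB Require Import structures.
From mathcomp Require Import all_boot all_order all_algebra.

Set Implicit Arguments.
Unset Strict Implicit.
Unset Printing Implicit Defensive.

Import GRing.Theory.
Local Open Scope ring_scope.

(* The inner division is exact for [u] prime to the prime [p], by Fermat's
   little theorem; the outer [%%] picks the representative in [0, p - 1]. *)
Definition fermat_quotient (p : nat) (u : int) : int :=
  if coprimez u p then (((u ^+ p.-1 - 1) %/ p)%Z %% p)%Z else 0.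

(* The order of [g] in the ring Z/nZ equals the order of its unit group; only
   meaningful for [1 < n], since ['Z_0] and ['Z_1] denote Z/2Z. *)
Definition primitive_root_mod (n : nat) (g : int) : bool :=
  (totient n).-primitive_root (g%:~R : 'Z_n).

(* The subscript [l] is read modulo [p]. *)
Definition D (p l : nat) : pred nat :=
  [pred u : nat | [&& (u < p ^ 2)%N, coprime u p
                    & fermat_quotient p u%:Z == (l %% p)%N%:Z]].

Definition D_poly (p l : nat) : {poly 'F_2} :=
  \sum_(0 <= u < p ^ 2 | u \in D p l) 'X^u.

Definition D_seq (p l : nat) (u : nat) : 'F_2 :=
  if (u %% p ^ 2)%N \in D p l then 1 else 0.

Definition algebraic_closure (F : fieldType) (K : closedFieldType)
    (iota : {rmorphism F -> K}) : Prop :=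
  forall z : K, algebraicOver iota z.

(* [T] is a period of [s], not necessarily the least one; [size g <= T] says
   that [g] has the form [\sum_(i < T) rho i *: 'X^i]. *)
Definition defining_pair (K : closedFieldType) (iota : {rmorphism 'F_2 -> K})
    (T : nat) (s : nat -> 'F_2) (g : {poly K}) (beta : K) : Prop :=
  [/\ odd T,
      forall u : nat, s (u + T)%N = s u,
      T.-primitive_root beta,
      (size g <= T)%N
    & forall u : nat, iota (s u) = g.[beta ^+ u]].

(* [G_poly iota p delta beta i] is G_(i * delta). *)
Definition G_poly (K : closedFieldType) (iota : {rmorphism 'F_2 -> K})
    (p delta : nat) (beta : K) (i : nat) : {poly K} :=
  \sum_(1 <= j < p) 'X^(j * p)
  + \sum_(0 <= j < p)
      (map_poly iota (D_poly p ((i + j) * delta))).[beta]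
      *: map_poly iota (D_poly p (j * delta)).

(* Main.v *)
(* In Z/p^2, write pi for the class of p, so that pi^2 = 0. For a unit u one has
   q_p(u) = l (mod p) exactly when u^(p-1) = 1 + pi l, which makes q_p additive
   on units. Let chi(w) = beta^w and x = u mod p^2. In the second sum of
   G(beta^u), substituting v = t w (v in D_((i+j) delta), w in D_(j delta))
   turns it into the sum over t in D_(i delta) of sum_w chi((t + x) w), with w
   running over all units, since p does not divide delta. In characteristic 2
   this inner Ramanujan sum is [t + x = 0] + [pi (t + x) = 0]. As D_l contains
   exactly one element of each nonzero residue class modulo p, and is stable
   under negation, the second sum equals [x in D_(i delta)] + [pi x <> 0]; the
   first sum equals 1 + [pi x = 0]. *)

Require Import Defs.
From HB Require Import structures.
From mathcomp Require Import all_boot all_order all_algebra.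
From mathcomp Require Import cyclic ring.

Set Implicit Arguments.
Unset Strict Implicit.
Unset Printing Implicit Defensive.

Import GRing.Theory.
Local Open Scope ring_scope.

(** * Fermat quotients read off from powers in Z/p^2 *)

Lemma natr_Zp_eq0 n (n_gt1 : (1 < n)%N) a : (a%:R == 0 :> 'Z_n) = (n %| a)%N.
Proof. by rewrite -val_eqE /= val_Zp_nat. Qed.

Lemma intr_Zp_eq0 n (n_gt1 : (1 < n)%N) (a : int) :
  (a%:~R == 0 :> 'Z_n) = (n %| a)%Z.
Proof.
case: a => m; first by rewrite dvdzE; apply: natr_Zp_eq0.
by rewrite NegzE mulrNz oppr_eq0 dvdzE abszN; apply: natr_Zp_eq0.
Qed.

(** The even exponent [p.-1] removes the sign of [u], which leaves Euler's theorem for natural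
    numbers. *)
Lemma fermat_int p (p_prime : prime p) (p_odd : odd p) (u : int) :
  coprimez u p -> (p %| u ^+ p.-1 - 1)%Z.
Proof.
move=> /Euler_exp_totient; rewrite totient_prime // => /eqP.
have -> : u ^+ p.-1 = (`|u| ^ p.-1)%N.
  rewrite [in LHS](intEsign u) exprMn -exprM mulnC exprM -signr_odd.
  have -> : odd p.-1 = false by case: p p_prime p_odd {u} => //= n _ /negbTE.
  by rewrite expr1n mul1r -[RHS]natz natrX natz.
by rewrite -eqz_mod_dvd -[1]/(1%N%:Z) !modz_nat eqz_nat.
Qed.

(** Writing u^(p-1) - 1 = b p, both sides say that p divides b - l: on the right, p (b - l) vanishes
    modulo p^2. *)
Lemma fermat_quotientE p (p_prime : prime p) (p_odd : odd p) (u : int) l :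
  coprimez u p ->
  (fermat_quotient p u == (l %% p)%N%:Z)
    = ((u%:~R : 'Z_(p ^ 2)) ^+ p.-1 == 1 + p%:R * l%:R).
Proof.
move=> cu; rewrite /fermat_quotient cu.
have p_gt0 := prime_gt0 p_prime; have p_gt1 := prime_gt1 p_prime.
have /dvdzP[b ub] := fermat_int p_prime p_odd cu.
rewrite ub mulzK; last by rewrite eqz_nat -lt0n.
have pp1 : (1 < p ^ 2)%N by rewrite -(exp1n 2) ltn_exp2r.
rewrite -modz_nat eqz_mod_dvd -[RHS]subr_eq0.
have -> : (u%:~R : 'Z_(p ^ 2)) ^+ p.-1 - (1 + p%:R * l%:R)
  = (p%:Z * (b - l%:Z))%:~R.
  rewrite mulrBr -[p%:Z * b]mulrC -ub !rmorphB rmorphXn rmorphM /=.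
  by rewrite -!pmulrn; ring.
by rewrite intr_Zp_eq0 // -mulnn PoszM dvdz_mul2l // eqz_nat -lt0n.
Qed.

Lemma sum_indicator (R : pzSemiRingType) (I : finType) (P Q : pred I) :
  \sum_(i | P i) (Q i)%:R = #|[pred i | P i & Q i]|%:R :> R.
Proof.
rewrite -natr_sum -sum1_card [in RHS](eq_bigl (fun i => P i && Q i)) //.
rewrite big_mkcondr /=.
by congr _%:R; apply: eq_bigr => i _; case: (Q i).
Qed.

(** * Fermat quotient classes of units modulo p^2 *)

Section RingModSquare.

Variables (p : nat) (p_prime : prime p) (p_odd : odd p).

Let p_gt0 : (0 < p)%N := prime_gt0 p_prime.
Let p_gt1 : (1 < p)%N := prime_gt1 p_prime.
Let pp_gt1 : (1 < p ^ 2)%N.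
Proof. by rewrite -(exp1n 2) ltn_exp2r. Qed.

Local Notation A := 'Z_(p ^ 2).
Local Notation pi := (p%:R : A).

(* q_p(w) = l modulo p, a unit w being implied. *)
Definition fq_class (l : nat) (w : A) : bool := w ^+ p.-1 == 1 + pi * l%:R.

Lemma mulr_pi_pi : pi * pi = 0.
Proof. by rewrite -natrM mulnn pchar_Zp. Qed.

Lemma mul_pi_nat_eq0 a : (pi * a%:R == 0) = (p %| a)%N.
Proof. by rewrite -natrM natr_Zp_eq0 // -mulnn dvdn_pmul2l. Qed.

Lemma mul_pi_eq0 (w : A) : (pi * w == 0) = (p %| w)%N.
Proof. by rewrite -mul_pi_nat_eq0 natr_Zp. Qed.

Lemma mul_pi_neq0_unit (w : A) : (pi * w != 0) = (w \is a GRing.unit).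
Proof.
by rewrite mul_pi_eq0 -[w in RHS]natr_Zp unitZpE // coprime_pexpl //
  prime_coprime.
Qed.

Lemma expr1Dpi (s : A) n : (1 + pi * s) ^+ n = 1 + pi * (s *+ n).
Proof.
have p0 := mulr_pi_pi.
elim: n => [|n IHn]; first by rewrite mulr0n mulr0 addr0.
rewrite exprS IHn mulrS.
transitivity (1 + pi * (s + s *+ n) + pi * pi * s * (s *+ n)); first by ring.
by rewrite p0 !mul0r addr0.
Qed.

(** The power w^(p-1) is invertible with inverse 1 - pi l, because pi^2 = 0. *)
Lemma fq_class_unit l w : fq_class l w -> w \is a GRing.unit.
Proof.
move=> /eqP wl; rewrite -(@unitrX_pos _ _ p.-1) ?wl; last first.
  by rewrite -ltnS prednK.
apply/unitrP; exists (1 - pi * l%:R).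
have p0 := mulr_pi_pi.
by split; (transitivity (1 - pi * pi * l%:R * l%:R); first by ring);
  rewrite p0 !mul0r subr0.
Qed.

Lemma D_fq_class l (w : A) : (w : nat) \in D p l = fq_class l w.
Proof.
rewrite !inE.
have -> : (w < p ^ 2)%N by rewrite -[X in (_ < X)%N](Zp_cast pp_gt1) ltn_ord.
rewrite coprime_sym -(@coprime_pexpl 2) // -unitZpE // natr_Zp /=.
have [uw|nuw] := boolP (w \is a GRing.unit); last first.
  by apply/esym/negP => /fq_class_unit; apply/negP.
rewrite fermat_quotientE //; last first.
  rewrite coprimezE /= coprime_sym -(@coprime_pexpl 2) // -unitZpE //.
  by rewrite natr_Zp.
by rewrite /fq_class -pmulrn natr_Zp.
Qed.

Lemma unit_fq_class w : w \is a GRing.unit -> exists l, fq_class l w.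
Proof.
move=> uw; have cw : coprimez (w : nat) p.
  rewrite coprimezE /= coprime_sym -(@coprime_pexpl 2) // -unitZpE //.
  by rewrite natr_Zp.
exists `|fermat_quotient p (w : nat)|%N.
rewrite /fq_class -[w in w ^+ _]natr_Zp [X in X ^+ _]pmulrn.
rewrite -fermat_quotientE //.
rewrite -modz_nat /fermat_quotient cw gez0_abs ?modz_mod //.
by rewrite modz_ge0 // eqz_nat -lt0n.
Qed.

Lemma fq_classN l w : fq_class l (- w) = fq_class l w.
Proof.
by rewrite /fq_class exprNn -signr_odd -subn1 oddB // p_odd mul1r.
Qed.

(** Additivity of q_p: (1 + pi k) (1 + pi l) = 1 + pi (k + l), and the unit w^(p-1) can be
    cancelled. *)
Lemma fq_classM k l v w :
  fq_class l w -> fq_class (k + l) (v * w) = fq_class k v.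
Proof.
move=> wl; have uw := fq_class_unit wl.
have p0 := mulr_pi_pi.
rewrite -[RHS](inj_eq (mulIr (unitrX p.-1 uw))) (eqP wl) /fq_class.
rewrite exprMn (eqP wl).
congr (_ == _).
transitivity (1 + pi * (k + l)%:R + pi * pi * k%:R * l%:R).
  by rewrite p0 !mul0r addr0.
by rewrite natrD; ring.
Qed.

(** The elements congruent to a unit y modulo p are y (1 + pi s). If y has class c, such an element
    has class c - s, so class l determines pi s. If pi y = 0, no candidate t is a unit. *)
Lemma card_fq_class_mod l y :
  #|[pred t | fq_class l t & pi * t == pi * y]| = (pi * y != 0).
Proof.
have p0 := mulr_pi_pi.
have [/eqP py0|] := boolP (pi * y == 0).
  apply: eq_card0 => t; rewrite !inE; apply/negP => /andP[/fq_class_unit ut].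
  by apply/negP; rewrite py0 mul_pi_neq0_unit.
rewrite mul_pi_neq0_unit => uy; have [c yc] := unit_fq_class uy.
transitivity #|pred1 (y * (1 + pi * (c%:R - l%:R)))|; last exact: card1.
apply: eq_card => t; rewrite !inE.
(* (1 + pi s)^(p-1) = 1 - pi s because p pi = 0. *)
have fqE s : fq_class l (y * (1 + pi * s)) = (pi * s == pi * (c%:R - l%:R)).
  rewrite /fq_class exprMn expr1Dpi (eqP yc) -subr_eq0 -[RHS]subr_eq0.
  rewrite -[RHS]oppr_eq0; congr (_ == 0).
  have -> : s *+ p.-1 = pi * s - s.
    by apply: (addIr s); rewrite subrK -mulrSr prednK // mulr_natl.
  transitivity (- (pi * s - pi * (c%:R - l%:R))
    + pi * pi * (s + c%:R * (pi * s - s))); first by ring.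
  by rewrite p0 mul0r addr0.
apply/andP/eqP => [[tl /eqP pty]|->]; last first.
  rewrite fqE eqxx; split=> //; apply/eqP.
  transitivity (pi * y + pi * pi * y * (c%:R - l%:R)); first by ring.
  by rewrite p0 !mul0r addr0.
(* Since t and y agree modulo p, pi kills t / y - 1, which is therefore a multiple of p. *)
have [s ts] : exists s, t = y * (1 + pi * s).
  have : pi * (t / y - 1) == 0.
    by rewrite mulrBr mulrA pty mulrK // mulr1 subrr.
  rewrite mul_pi_eq0 => /dvdnP[s es]; exists s%:R.
  by rewrite -natrM mulnC -es natr_Zp addrC subrK mulrC divrK.
by move: tl; rewrite ts fqE => /eqP->.
Qed.

Lemma fq_class_mod c l w : fq_class c w -> fq_class l w = (l == c %[mod p]).
Proof.
move=> /eqP wc; rewrite /fq_class wc (inj_eq (addrI _)) -!natrM eq_sym.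
by rewrite -val_eqE /= !val_Zp_nat // -mulnn -!muln_modr eqn_pmul2l.
Qed.

Lemma muln_mod_inj (delta : nat) (p'delta : ~~ (p %| delta)%N) :
  injective (fun j : 'I_p => Ordinal (ltn_pmod (j * delta) p_gt0)).
Proof.
move=> j k /(congr1 val) /= /eqP; wlog le_kj : j k / (k <= j)%N.
  by move=> W; case: (leqP k j) => [|/ltnW] /W//; rewrite eq_sym => W' /W'.
rewrite eqn_mod_dvd ?leq_mul2r ?le_kj ?orbT // -mulnBl Euclid_dvdM //.
rewrite (negbTE p'delta) orbF -eqn_mod_dvd // !modn_small // => /eqP.
exact: val_inj.
Qed.

(** Multiplication by [delta] permutes the residues modulo p, so the classes of j delta partition
    the units. *)
Lemma sum_fq_class (R : nmodType) (delta : nat) (F : A -> R) :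
  ~~ (p %| delta)%N ->
  \sum_(0 <= j < p) \sum_(w | fq_class (j * delta) w) F w
    = \sum_(w | pi * w != 0) F w.
Proof.
move=> p'delta; rewrite big_mkord.
rewrite (exchange_big_dep (fun w => pi * w != 0)) /=; last first.
  by move=> j w _ /fq_class_unit; rewrite mul_pi_neq0_unit.
apply: eq_bigr => w; rewrite mul_pi_neq0_unit => /unit_fq_class[c wc].
have inj := muln_mod_inj p'delta.
(* The only index is the preimage of the class c of w under j -> j delta modulo p. *)
rewrite (big_pred1 (invF inj (Ordinal (ltn_pmod c p_gt0)))) // => j.
rewrite /= -(can2_eq (invF_f inj) (f_invF inj)) -val_eqE /=.
by rewrite (fq_class_mod _ wc).
Qed.

Lemma sum_Zp_nat (R : nmodType) (P : pred nat) (F : nat -> R) :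
  \sum_(0 <= k < p ^ 2 | P k) F k = \sum_(w : A | P w) F w.
Proof. by rewrite -{1}(Zp_cast pp_gt1) big_mkord. Qed.

(** * Character sums in characteristic 2 *)

Section CharacterSums.

Variables (K : fieldType) (char2 : 2 \in [pchar K]).
Variables (beta : K) (beta_root : (p ^ 2).-primitive_root beta).

Definition chi (w : A) : K := beta ^+ w.

(** As beta^(p^2) = 1, the exponent may be any representative; this makes [chi] an additive
    character. *)
Lemma chi_nat k : chi k%:R = beta ^+ k.
Proof. by rewrite /chi val_Zp_nat // (prim_expr_mod beta_root). Qed.

Lemma chiD v w : chi (v + w) = chi v * chi w.
Proof. by rewrite -[v]natr_Zp -[w]natr_Zp -natrD !chi_nat exprD. Qed.

Lemma chiM_nat v k : chi (v * k%:R) = chi v ^+ k.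
Proof. by rewrite -[v]natr_Zp -natrM !chi_nat exprM. Qed.

Lemma chi_eq1 w : (chi w == 1) = (w == 0).
Proof. by rewrite -(prim_order_dvd beta_root) -natr_Zp_eq0 // natr_Zp. Qed.

(** At z = 1 the sum is n, which is 1 since n is odd; otherwise z - 1 is nonzero and its product
    with the sum is z^n - 1 = 0. *)
Lemma sum_unity_root_char2 n (z : K) :
  odd n -> z ^+ n = 1 -> \sum_(0 <= j < n) z ^+ j = (z == 1)%:R.
Proof.
move=> n_odd zn1; rewrite big_mkord; have [->|z_neq1] := eqVneq z 1.
  under eq_bigr do rewrite expr1n.
  rewrite sumr_const card_ord -[n]odd_double_half n_odd natrD -muln2 natrM.
  by rewrite (pcharf0 char2) mulr0 addr0.
have /esym/eqP := subrX1 z n; rewrite zn1 subrr mulf_eq0 subr_eq0.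
by rewrite (negbTE z_neq1) => /eqP.
Qed.

Lemma sum_chi_mul_pi n :
  \sum_(0 <= j < p) chi (n * (pi * j%:R)) = (pi * n == 0)%:R.
Proof.
under eq_bigr do rewrite mulrA chiM_nat.
rewrite sum_unity_root_char2 //; first by rewrite chi_eq1 mulrC.
by rewrite -chiM_nat -mulrA mulr_pi_pi mulr0 /chi expr0.
Qed.

Lemma sum_chi_ker_pi n : \sum_(w | pi * w == 0) chi (n * w) = (pi * n == 0)%:R.
Proof.
rewrite -sum_chi_mul_pi big_mkord.
(* The kernel of pi consists of the pi j with j < p. The inverse map divides by p; reducing modulo p
   there only supplies the ordinal's bound. *)
rewrite (reindex_onto (fun j : 'I_p => pi * j%:R)
  (fun w : A => Ordinal (ltn_pmod (w %/ p) p_gt0))); last first.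
  move=> w; rewrite mul_pi_eq0 // => /dvdnP[k wk].
  have k_lt : (k < p)%N.
    rewrite -(ltn_pmul2r p_gt0) -wk mulnn -[X in (_ < X)%N](Zp_cast pp_gt1).
    exact: ltn_ord.
  by rewrite /= wk mulnK // modn_small // -natrM mulnC -wk natr_Zp.
apply: eq_bigl => j; rewrite mulrA mulr_pi_pi mul0r eqxx -natrM.
apply/eqP/val_inj; rewrite [RHS]/= -[RHS](modn_small (ltn_ord j)) /=.
by rewrite val_Zp_nat // -mulnn -muln_modr mulKn // modn_mod.
Qed.

Lemma sum_chi_all n : \sum_w chi (n * w) = (n == 0)%:R.
Proof.
rewrite -chi_eq1 -(@sum_unity_root_char2 (p ^ 2)) ?oddX //.
  rewrite (sum_Zp_nat predT).
  by apply: eq_bigr => w _; rewrite -chiM_nat natr_Zp.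
by rewrite -chiM_nat pchar_Zp // mulr0.
Qed.

(** A Ramanujan sum: all residues minus the kernel of pi, where minus is plus in characteristic
    2. *)
Lemma sum_chi_unit n :
  \sum_(w | pi * w != 0) chi (n * w) = (n == 0)%:R + (pi * n == 0)%:R.
Proof.
rewrite -sum_chi_all -sum_chi_ker_pi.
rewrite [X in _ = X + _](bigID (fun w : A => pi * w == 0)).
by rewrite [RHS]addrAC (addrr_pchar2 char2) add0r.
Qed.

Lemma sum_chi_fq_class k l x :
  (\sum_(v | fq_class (k + l) v) chi v) * (\sum_(w | fq_class l w) chi (x * w))
    = \sum_(t | fq_class k t) \sum_(w | fq_class l w) chi ((t + x) * w).
Proof.
rewrite mulrC big_distrlr [RHS]exchange_big /=; apply: eq_bigr => w wl.
have uw := fq_class_unit wl.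
(* Substitution v = t w for a fixed unit w: v has class k + l exactly when t has class k. *)
rewrite (reindex_onto (fun t => t * w) (fun v => v / w)) /=; last first.
  by move=> v _; rewrite divrK.
apply: eq_big => [t|t _]; first by rewrite mulrK // eqxx andbT fq_classM.
by rewrite mulrDl chiD mulrC.
Qed.

(** The Ramanujan sum leaves two counts: t = -x, settled by stability under negation, and t
    congruent to -x modulo p, with one solution in the class if x is a unit and none otherwise. *)
Lemma sum_chi_fq_class_shift l x :
  \sum_(t | fq_class l t) \sum_(w | pi * w != 0) chi ((t + x) * w)
    = (fq_class l x)%:R + (pi * x != 0)%:R.
Proof.
under eq_bigr do rewrite sum_chi_unit.
rewrite big_split /= !sum_indicator; congr (_%:R + _%:R).
  rewrite -fq_classN; have [xl|/negbTE xl] := boolP (fq_class l (- x)).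
    apply: (@eq_card1 _ (- x)) => t.
    by rewrite !inE addr_eq0; case: eqP => [->|]; rewrite ?xl ?andbF.
  apply: eq_card0 => t.
  by rewrite !inE addr_eq0; case: eqP => [->|]; rewrite ?xl ?andbF.
rewrite -oppr_eq0 -mulrN -(card_fq_class_mod l); apply: eq_card => t.
by rewrite !inE mulrDr addr_eq0 mulrN.
Qed.

End CharacterSums.

(** * Values and sizes of the polynomials, and the condition on [delta] *)

Lemma D_poly_eval (K : fieldType) (iota : {rmorphism 'F_2 -> K}) l (y : K) :
  (map_poly iota (D_poly p l)).[y] = \sum_(w | fq_class l w) y ^+ (w : A).
Proof.
rewrite /D_poly rmorph_sum horner_sum /=.
under eq_bigr do rewrite map_polyXn hornerXn.
by rewrite sum_Zp_nat; apply: eq_bigl => w; rewrite D_fq_class.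
Qed.

Lemma size_D_poly l : (size (D_poly p l) <= p ^ 2)%N.
Proof.
apply: (@big_ind _ (fun q : {poly _} => (size q <= p ^ 2)%N)).
- by rewrite size_poly0.
- by move=> q r qs rs; rewrite (leq_trans (size_polyD _ _)) // geq_max qs.
- by move=> u; rewrite size_polyXn inE => /andP[].
Qed.

Lemma size_G_poly (K : closedFieldType) (iota : {rmorphism 'F_2 -> K})
    delta (beta : K) i :
  (size (G_poly iota p delta beta i) <= p ^ 2)%N.
Proof.
have sizeD (q r : {poly K}) :
    (size q <= p ^ 2 -> size r <= p ^ 2 -> size (q + r)%R <= p ^ 2)%N.
  by move=> qs rs; rewrite (leq_trans (size_polyD _ _)) // geq_max qs.
apply: (sizeD _ _).
  rewrite big_nat; apply: (big_ind _ _ sizeD) => [|j /andP[_ j_lt]].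
    by rewrite size_poly0.
  by rewrite size_polyXn -mulnn ltn_pmul2r.
apply: (big_ind _ _ sizeD) => [|j _]; first by rewrite size_poly0.
by rewrite (leq_trans (size_scale_leq _ _)) // size_map_poly size_D_poly.
Qed.

(** If p divided [delta], then g^(p-1) = 1 modulo p^2, against the order p (p - 1) of g. *)
Lemma primitive_root_fermat_quotient (g : int) (delta : nat) :
  primitive_root_mod (p ^ 2) g -> fermat_quotient p g = delta%:Z ->
  ~~ (p %| delta)%N.
Proof.
move=> g_root gd; have tot := totient_pfactor p_prime (isT : (0 < 2)%N).
have tot_gt0 : (0 < totient (p ^ 2))%N by rewrite totient_gt0 expn_gt0 p_gt0.
apply/negP => p_delta.
have ug : (g%:~R : A) \is a GRing.unit.
  by rewrite -(unitrX_pos _ tot_gt0) (prim_expr_order g_root) unitr1.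
have cg : coprimez g p.
  rewrite coprimezE /= coprime_sym -(@coprime_pexpl 2) // -unitZpE //.
  by case: g ug {g_root gd} => m //; rewrite NegzE mulrNz unitrN.
have : fermat_quotient p g == (delta %% p)%N%:Z.
  (* As a Fermat quotient, [delta] is already reduced modulo p. *)
  rewrite gd modn_small //.
  by rewrite -ltz_nat -gd /fermat_quotient cg ltz_pmod.
rewrite fermat_quotientE // (eqP (_ : pi * _ == 0)) ?mul_pi_nat_eq0 // addr0.
rewrite -(prim_order_dvd g_root) tot expn1 => /dvdn_leq.
have : (0 < p.-1)%N by rewrite -ltnS prednK.
by move=> p1 /(_ p1); rewrite leqNgt ltn_Pmulr.
Qed.

End RingModSquare.

Theorem lemma3 (p : nat) (p_prime : prime p) (p_odd : odd p)
    (g : int) (g_root : primitive_root_mod (p ^ 2) g)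
    (delta : nat) (g_delta : fermat_quotient p g = delta%:Z)
    (K : closedFieldType) (iota : {rmorphism 'F_2 -> K})
    (K_closure : algebraic_closure iota)
    (beta : K) (beta_root : (p ^ 2).-primitive_root beta)
    (i : nat) (i_lt_p : (i < p)%N) :
  defining_pair iota (p ^ 2) (D_seq p (i * delta))
    (G_poly iota p delta beta i) beta.
Proof.
split=> [|u|//||u]; rewrite ?oddX ?p_odd //.
- by rewrite /D_seq modnDr.
- exact: size_G_poly.
have char2 : 2 \in [pchar K] by apply: (rmorph_pchar iota); apply: pchar_Fp.
have pp_gt1 : (1 < p ^ 2)%N by rewrite -(exp1n 2) ltn_exp2r ?prime_gt1.
have p'delta := primitive_root_fermat_quotient p_prime p_odd g_root g_delta.
pose x : 'Z_(p ^ 2) := u%:R; pose X := @chi p K beta.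
have Xx n : (beta ^+ u) ^+ n = X (x * n%:R).
  by rewrite -exprM /X /x -natrM chi_nat.
have -> : iota (D_seq p (i * delta) u) = (fq_class (i * delta) x)%:R.
  rewrite /D_seq -val_Zp_nat // -/x D_fq_class //.
  by case: fq_class; rewrite ?rmorph1 ?rmorph0.
rewrite /G_poly hornerD !horner_sum.
(* The full sum over multiples of p has one more term, j = 0, equal to 1; in characteristic 2
   removing it is adding 1. *)
have -> : \sum_(1 <= j < p) ('X^(j * p)).[beta ^+ u] = 1 + (p%:R * x == 0)%:R.
  rewrite -(sum_chi_mul_pi p_prime p_odd char2 beta_root).
  rewrite [X in _ = 1 + X]big_ltn ?prime_gt0 // !mulr0 [chi _ 0]expr0.
  rewrite addrA (addrr_pchar2 char2) add0r.
  apply: eq_bigr => j _; rewrite hornerXn Xx natrM.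
  by congr (X _); ring.
have -> : \sum_(0 <= j < p)
    ((map_poly iota (D_poly p ((i + j) * delta))).[beta]
      *: map_poly iota (D_poly p (j * delta))).[beta ^+ u]
  = (fq_class (i * delta) x)%:R + (p%:R * x != 0)%:R.
  rewrite -(sum_chi_fq_class_shift p_prime p_odd char2 beta_root).
  (* Splitting the sum over units into the classes of j delta lets both sides be compared for each
     j. *)
  under [RHS]eq_bigr do rewrite -(sum_fq_class p_prime p_odd _ p'delta).
  rewrite [RHS]exchange_big; apply: eq_bigr => j _ /=.
  rewrite hornerZ !D_poly_eval // mulnDl.
  rewrite -(sum_chi_fq_class p_prime beta_root).
  congr (_ * _); apply: eq_bigr => w _.
  by rewrite Xx natr_Zp.
(* Exactly one of the indicators of pi x = 0 and pi x <> 0 is 1, and it cancels the constant 1. *)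
case: (_ == 0); first by rewrite (addrr_pchar2 char2) add0r addr0.
by rewrite addr0 addrCA (addrr_pchar2 char2) addr0.
Qed.
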